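(* Let $p$ be an odd prime and let $G=\langle x,y\rangle$ be a metabelian $p$-group with two generators $x,y$, having abelianization $G/G'$ of type $(p,p)$, nilpotency class $m-1$ and coclass $e-1\ge 2$, and satisfying the independence condition $\Sigma_3\cap T_3=1$, that is, with defect of commutativity $k=0$. For $3\le j\le m$ and $3\le\ell\le e+1$ put $P_{j,\ell}=\Sigma_j\times T_\ell$. Then the complete normal lattice of $G$ (the lattice of all normal subgroups of $G$) contains the heading diamond $(G,G')$ and the rectangle $\bigl((P_{j,\ell},P_{j+1,\ell+1})\bigr)_{3\le j\le m-1,\ 3\le\ell\le e}$ of trailing diamonds. That is, $(G,G')$ and all pairs $(P_{j,\ell},P_{j+1,\ell+1})$ with $3\le j\le m-1$, $3\le\ell\le e$ are diamonds, and for each of these diamonds $(U,V)$ the subgroups $U$, $V$ and all $p+1$ intermediate subgroups between $U$ and $V$ are normal subgroups of $G$.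
   Context: Commutators: $[a,b]=a^{-1}b^{-1}ab$. A $p$-group is metabelian if its commutator subgroup $G'$ is abelian. Type $(p,p)$ means elementary abelian of order $p^2$. Lower central series: $\gamma_1(G)=G$, $\gamma_j(G)=[\gamma_{j-1}(G),G]$ for $j\ge 2$, so $\gamma_2(G)=G'$. Setting. $G$ is finite of order $p^n$, of nilpotency class $m-1$ (so $\gamma_{m-1}(G)\ne 1=\gamma_m(G)$) and coclass $n-m+1=e-1$; coclass at least $2$ means $e\ge 3$. Let $s_2=t_2=[y,x]$ be the main commutator, and put $s_j=[s_{j-1},x]$ for $j\ge 3$ and $t_\ell=[t_{\ell-1},y]$ for $\ell\ge 3$. Let $\Sigma_j=\langle s_j,\ldots,s_{m-1}\rangle$ and $T_\ell=\langle t_\ell,\ldots,t_{e+1}\rangle$ for $j,\ell\ge 3$, with $\Sigma_m=1$. For coclass at least $2$ one is in the case $t_3\notin\Sigma_3$, $\gamma_3(G)=\langle s_3,t_3,\gamma_4(G)\rangle$, $m<n$. Within this case, defect of commutativity $k=0$ is characterized by $t_{e+1}=1$, where $\Sigma_3\cap T_3=1$; thus $T_{e+1}=1$ and $P_{j,\ell}=\langle s_j,\ldots,s_{m-1}\rangle\times\langle t_\ell,\ldots,t_e\rangle$ for $3\le j\le m-1$, $3\le\ell\le e$. Diamond: a pair $(U,V)$ of normal subgroups of $G$ with $V<U\le G$ and $(U:V)=p^2$ such that the quotient $U/V$ is abelian of type $(p,p)$. If $U=\langle u_1,u_2,V\rangle$, the $p+1$ intermediate subgroups between $U$ and $V$ are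 $\langle u_2,V\rangle$ and $\langle u_1u_2^{i-2},V\rangle$ with $2\le i\le p+1$.
   Formalization: The generators x, y are additionally assumed adapted: [s_3,y] lies in Σ_3 and [t_3,x] lies in T_3. Without this the claim fails (e.g. a group of order 5^6); both conditions are necessary for the conclusion. *)

(* Defs.v *)
From mathcomp Require Import all_boot all_fingroup all_solvable.

Set Implicit Arguments.
Unset Strict Implicit.
Unset Printing Implicit Defensive.

Import GroupScope.

Section MetabelianDiamonds.

Variable gT : finGroupType.
Implicit Types (G U V H : {group gT}) (x y : gT) (p m e j l : nat).

(* s_2 = t_2 = [y,x]; the values at indices 0 and 1 are junk, never used. *)
Definition s_comm x y j : gT := iter (j - 2) (fun c => [~ c, x]) [~ y, x].
Definition t_comm x y l : gT := iter (l - 2) (fun c => [~ c, y]) [~ y, x].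

(* The generators of Sigma_j have indices j, ..., m-1 (so Sigma_m = 1), those
   of T_l have indices l, ..., e+1. *)
Definition Sigma x y m j : {group gT} :=
  <<\bigcup_(j <= i < m) [set s_comm x y i]>>%G.
Definition Tau x y e l : {group gT} :=
  <<\bigcup_(l <= i < e.+2) [set t_comm x y i]>>%G.

(* The join always is a group; that it is the direct product Sigma_j x T_l
   depends on the independence condition, and is asserted separately. *)
Definition Pgroup x y m e j l : {group gT} :=
  (Sigma x y m j <*> Tau x y e l)%G.

Definition coclass p G : nat := logn p #|G| - nil_class G.

Definition type_pp p (rT : finGroupType) (A : {group rT}) : bool :=
  p.-abelem A && (#|A| == p ^ 2)%N.

Definition diamond p G U V : Prop :=
  [/\ U <| G, V <| G, V \proper U, #|U : V| = (p ^ 2)%N & type_pp p (U / V)].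

Definition normal_lattice G : {set {group gT}} := [set H : {group gT} | H <| G].

Definition interval U V : {set {group gT}} :=
  [set H : {group gT} | (V \subset H) && (H \subset U)].

Definition intermediate U V : {set {group gT}} :=
  [set H : {group gT} | (V \proper H) && (H \proper U)].

(* (U, V) is a diamond with exactly p + 1 intermediate subgroups, and U, V and
   the intermediate subgroups all lie in the normal lattice of G. *)
Definition diamond_in_normal_lattice p G U V : Prop :=
  [/\ diamond p G U V, #|intermediate U V| = p.+1
    & interval U V \subset normal_lattice G].

End MetabelianDiamonds.

(* Main.v *)
(** Since [G'] is abelian, commutation with [x] and commutation with [y] commute
    on [G'].  Hence [[s_3, y] = [t_3, x]], an element of [Sigma_3 :&: T_3 = 1],
    so that [y] centralises every [s_j] and [x] every [t_l] with [j, l >= 3];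
    the groups [Sigma_j], [T_l] are then normal in [G], and commutation with [G]
    moves each one step down its chain.  As [x ^+ p] and [y ^+ p] lie in [G'],
    each step of the two chains has index at most [p], and so has [P_(3, 3)] in
    [G'].  Therefore [#|G| <= p ^ (m + e - 2)]; the class and the coclass say
    that equality holds, so every step has index exactly [p]. *)
Require Import Defs.
From mathcomp Require Import all_boot all_fingroup all_solvable.
From mathcomp Require Import zify.

Set Implicit Arguments.
Unset Strict Implicit.
Unset Printing Implicit Defensive.

Import GroupScope.

(** * Commutator identities modulo a normalised subgroup *)

Section Commutators.

Variable gT : finGroupType.
Implicit Types (A : {set gT}) (G H K U V : {group gT}) (a x y z : gT).

(** Since [x * y = y * x * [~ x, y]] and [[~ x, y]] centralises the abelian group
    [G^](1)[, conjugating]a[by]x[and by]y[can be done in either order. Both sides then expand to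
    products of the same four elements of]G^[(1)]. *)
Lemma commgC_der1_abelian G a x y :
    abelian G^`(1) -> a \in G^`(1) -> x \in G -> y \in G ->
  [~ [~ a, x], y] = [~ [~ a, y], x].
Proof.
move=> abG' G'a Gx Gy.
have nG' z : z \in G -> z \in 'N(G^`(1)) by apply/subsetP/der_norm.
have G'J b z : b \in G^`(1) -> z \in G -> b ^ z \in G^`(1).
  by move=> G'b Gz; rewrite memJ_norm ?nG'.
have cG' b c : b \in G^`(1) -> c \in G^`(1) -> commute b c.
  by move=> G'b G'c; apply: (centsP abG').
have Eaxy : (a ^ x) ^ y = (a ^ y) ^ x.
  rewrite -!conjgM commgC conjgM; apply/conjg_fixP/commgP/cG'.
    by rewrite conjgM !G'J.
  by rewrite mem_commg.
rewrite !commgEl !(conjMg a^-1) !(conjVg a) Eaxy.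
have := G'J _ _ G'a Gy; have := G'J _ _ G'a Gx.
move: (a ^ x) (a ^ y) ((a ^ y) ^ x) => b c d G'b G'c.
rewrite !(invMg a^-1) !invgK !mulgA; congr (_ * _).
rewrite -!mulgA (cG' a) ?groupV // (cG' a b^-1) ?groupV // !mulgA.
by congr (_ * _); apply: cG'; rewrite groupV.
Qed.

(** Modulo [K] the claim is that one group centralises another, which can be tested on generators of
    both. *)
Lemma commg_gen_sub G K A x y :
    G :=: <<[set x; y]>> -> A \subset 'N(K) -> G \subset 'N(K) ->
    {in A, forall a, [~ a, x] \in K} -> {in A, forall a, [~ a, y] \in K} ->
  [~: <<A>>, G] \subset K.
Proof.
move=> genG nKA nKG Kx Ky.
have nKxy : [set x; y] \subset 'N(K) by rewrite -gen_subG -genG.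
rewrite -quotient_cents2 ?gen_subG // genG !quotient_gen // cent_gen gen_subG.
rewrite quotient_cents2 // gen_subG.
by apply/subsetP=> _ /imset2P[a b Aa /set2P[]-> ->]; auto.
Qed.

Lemma norm_genP A x : {in A, forall a, a ^ x \in <<A>>} -> x \in 'N(<<A>>).
Proof.
move=> AJ; rewrite inE -genJ gen_subG.
by apply/subsetP=> _ /imsetP[a Aa ->]; apply: AJ.
Qed.

(** Modulo [K] the commutator [[~ a, x]] commutes with [x], so its [n]-th power becomes
    [[~ a, x ^+ n]]. *)
Lemma commgX_mem K a x n :
    a \in 'N(K) -> x \in 'N(K) -> [~ [~ a, x], x] \in K ->
  [~ a, x ^+ n] \in K -> [~ a, x] ^+ n \in K.
Proof.
move=> nKa nKx Kaxx Kaxn; have nKax : [~ a, x] \in 'N(K) by rewrite groupR.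
apply: coset_idr; first exact: groupX.
rewrite morphX ?morphR //= -commgX.
  by rewrite -morphX // -morphR ?groupX //= coset_id.
apply/commute_sym/commgP.
by rewrite -!morphR //= coset_id.
Qed.

Lemma card_cycleY_le K z n :
  z \in 'N(K) -> 0 < n -> z ^+ n \in K -> #|<[z]> <*> K| <= n * #|K|.
Proof.
move=> nKz n_gt0 Kzn; have nKZ : <[z]> \subset 'N(K) by rewrite cycle_subG.
rewrite -(Lagrange (joing_subr <[z]> K)) mulnC leq_mul2r; apply/orP; right.
rewrite -card_quotient ?join_subG ?nKZ ?normG // quotientYidr //.
rewrite quotient_cycle // dvdn_leq // order_dvdn -morphX //=.
by rewrite coset_id.
Qed.

End Commutators.

(** * Descending chains generated by iterated commutators *)

Section Chain.

Variable gT : finGroupType.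

(** Common form of [Sigma] and [Tau], to which it is convertible. The bound [n] is kept apart from
    the index [k] at which [c] becomes trivial: [Sigma] has [k = n = m], whereas [Tau] has
    [k = e.+1] and [n = e.+2]. For [Tau] the roles of [x] and [y] are exchanged. *)
Definition chain (c : nat -> gT) n j : {group gT} :=
  <<\bigcup_(j <= i < n) [set c i]>>%G.

Lemma mem_chain c n j i : j <= i < n -> c i \in chain c n j.
Proof.
move=> lt_jin; rewrite mem_gen // (bigD1_seq i) ?iota_uniq //=.
  by rewrite inE set11.
by rewrite mem_index_iota.
Qed.

Lemma bigcup_chainP (c : nat -> gT) n j a :
  a \in \bigcup_(j <= i < n) [set c i] -> exists2 i, j <= i < n & a = c i.
Proof.
rewrite big_nat; elim/big_rec: _ => [|i B lt_jin IH]; first by rewrite inE.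
by case/setUP=> [/set1P->|/IH//]; exists i.
Qed.

Lemma chain_subP c n j (H : {group gT}) :
  (forall i, j <= i < n -> c i \in H) -> chain c n j \subset H.
Proof.
move=> Hc; rewrite gen_subG; apply/subsetP=> _ /bigcup_chainP[i lt_jin ->].
exact: Hc.
Qed.

Lemma chainS c n i j : i <= j -> chain c n j \subset chain c n i.
Proof.
move=> le_ij; apply: chain_subP => h /andP[le_jh lt_hn].
by rewrite mem_chain // lt_hn (leq_trans le_ij).
Qed.

Variables (G : {group gT}) (x y : gT) (c : nat -> gT) (p k n : nat).
Hypotheses (p_gt0 : 0 < p) (genG : G :=: <<[set x; y]>>).
Hypotheses (abG' : abelian G^`(1)) (G'xp : x ^+ p \in G^`(1)).
Hypotheses (k_gt1 : 1 < k) (le_kn : k <= n).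
Hypotheses (G'c : forall i, c i \in G^`(1)) (ck1 : c k = 1).
Hypothesis cx : forall i, 2 <= i -> [~ c i, x] = c i.+1.
Hypothesis cy : forall i, 3 <= i -> [~ c i, y] = 1.

Local Notation C := (chain c n).

Let Gx : x \in G. Proof. by rewrite genG mem_gen ?set21. Qed.

Lemma chain_sub_der1 j : C j \subset G^`(1).
Proof. by apply: chain_subP => i _; apply: G'c. Qed.

Lemma chain_gen_eq1 i : k <= i -> c i = 1.
Proof.
elim: i => [|i IH]; first by rewrite leqNgt (ltnW k_gt1).
rewrite leq_eqVlt => /predU1P[<- //|le_ki].
by rewrite -cx ?IH ?comm1g // (leq_trans k_gt1).
Qed.

(** No upper bound on [i] is imposed, because the terms from [n] on are trivial; so a shift from
    [c i] to [c i.+1] never leaves the chain. *)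
Lemma chain_succ_mem i j : j <= i -> c i \in C j.
Proof.
move=> le_ji; have [lt_in | le_ni] := ltnP i n.
  by rewrite mem_chain ?le_ji.
by rewrite chain_gen_eq1 ?group1 // (leq_trans le_kn).
Qed.

(** Conjugation by [x] multiplies [c i] by [c i.+1], and conjugation by [y] fixes [c i]. *)
Lemma chain_normal j : 3 <= j -> C j <| G.
Proof.
move=> j_ge3; rewrite /normal (subset_trans (chain_sub_der1 j)) ?der_sub //=.
rewrite genG gen_subG subUset !sub1set; apply/andP; split.
  apply: norm_genP => _ /bigcup_chainP[i /andP[le_ji lt_in] ->].
  rewrite conjg_mulR cx; last exact: leq_trans (ltnW j_ge3) le_ji.
  by apply: groupM; apply: chain_succ_mem => //; apply: leqW.
apply: norm_genP => _ /bigcup_chainP[i /andP[le_ji lt_in] ->].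
rewrite conjg_mulR cy; last exact: leq_trans j_ge3 le_ji.
by rewrite mulg1; apply: chain_succ_mem.
Qed.

Lemma chain_comm j : 3 <= j -> [~: C j, G] \subset C j.+1.
Proof.
move=> j_ge3; have [_ nCG] := andP (chain_normal (leqW j_ge3)).
have sCG : C j \subset G by case/andP: (chain_normal j_ge3).
apply: (commg_gen_sub genG) => //.
- by rewrite -gen_subG; apply: subset_trans nCG.
- move=> _ /bigcup_chainP[i /andP[le_ji _] ->].
  by rewrite cx ?chain_succ_mem // (leq_trans (ltnW j_ge3)).
- move=> _ /bigcup_chainP[i /andP[le_ji _] ->].
  by rewrite cy ?group1 // (leq_trans j_ge3).
Qed.

Lemma chain_gen_expn j : 3 <= j -> c j ^+ p \in C j.+1.
Proof.
case: j => // j j_ge2; have [_ nCG] := andP (chain_normal (leqW j_ge2)).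
have Gc i : c i \in G by apply: subsetP (der_sub 1 G) _ (G'c i).
rewrite -cx //; apply: commgX_mem.
- exact: subsetP nCG _ (Gc j).
- exact: subsetP nCG _ Gx.
- by rewrite !cx ?chain_succ_mem // leqW.
- by have /commgP/eqP-> := centsP abG' _ (G'c j) _ G'xp; apply: group1.
Qed.

Lemma chain_sub_cycleY j : C j \subset <[c j]> <*> C j.+1.
Proof.
apply/chain_subP => i /andP[].
rewrite leq_eqVlt => /predU1P[<- _|lt_ji lt_in].
  by rewrite -cycle_subG joing_subl.
by rewrite (subsetP (joing_subr _ _)) // chain_succ_mem.
Qed.

Lemma chain_expn j a : 3 <= j -> a \in C j -> a ^+ p \in C j.+1.
Proof.
move=> j_ge3 /(subsetP (chain_sub_cycleY j)).
have scG' : <[c j]> \subset G^`(1) by rewrite cycle_subG.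
have sCG' := chain_sub_der1 j.+1.
rewrite norm_joinEl ?cents_norm ?(sub_abelian_cent2 abG') //.
case/mulsgP=> _ b /cycleP[i ->] Cb ->; rewrite expgMn; last first.
  by apply: (centsP abG'); [apply/groupX/G'c | apply: subsetP Cb].
have Ccp := chain_gen_expn j_ge3.
by rewrite groupM ?(groupX p Cb) // -expgM mulnC expgM groupX.
Qed.

Lemma card_chain_step j : 3 <= j -> #|C j| <= p * #|C j.+1|.
Proof.
move=> j_ge3; have [_ nCG] := andP (chain_normal (leqW j_ge3)).
have nCc : c j \in 'N(C j.+1).
  by apply: subsetP nCG _ _; apply: subsetP (der_sub 1 G) _ (G'c j).
apply: leq_trans (card_cycleY_le nCc p_gt0 (chain_gen_expn j_ge3)).
exact/subset_leq_card/chain_sub_cycleY.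
Qed.

(** There are [k - j] steps of index at most [p] down to the trivial group [C k]. *)
Lemma card_chain_le j : 3 <= j -> #|C j| <= p ^ (k - j).
Proof.
move=> j_ge3; have [i] := ubnP (k - j).
elim: i j j_ge3 => // i IH j j_ge3 lt_kj; have [le_kj | lt_jk] := leqP k j.
  suff /trivGP-> : C j \subset 1%G by rewrite cards1 expn_gt0 p_gt0.
  apply: chain_subP => h /andP[le_jh _].
  by rewrite chain_gen_eq1 ?group1 // (leq_trans le_kj).
apply: leq_trans (card_chain_step j_ge3) _.
rewrite -(subnSK lt_jk) expnS leq_mul2l IH ?orbT //; first exact: leqW.
by rewrite -(subnSK lt_jk) in lt_kj.
Qed.

Lemma card_chain_ge i : #|C 3| <= p ^ i * #|C (3 + i)|.
Proof.
elim: i => [|i IH]; first by rewrite mul1n addn0.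
rewrite (leq_trans IH) // expnSr -mulnA leq_mul2l addnS.
by rewrite card_chain_step ?orbT ?leq_addr.
Qed.

(** If the bound is attained at the top of the chain, no step below can have index smaller than
    [p]. *)
Lemma card_chain j : #|C 3| = (p ^ (k - 3))%N -> 3 <= j <= k ->
  #|C j| = (p ^ (k - j))%N.
Proof.
move=> oC3 /andP[j_ge3 le_jk]; apply/eqP; rewrite eqn_leq card_chain_le //=.
have := card_chain_ge (j - 3); rewrite oC3 subnKC //.
have -> : (k - 3 = (j - 3) + (k - j))%N by rewrite addnBAC // subnKC.
by rewrite expnD leq_pmul2l // expn_gt0 p_gt0.
Qed.

End Chain.

(** * Diamonds whose quotient is central *)

Section Diamonds.

Variable gT : finGroupType.
Implicit Types (G H K U V : {group gT}) (x y : gT) (p m e j l : nat).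

(** By the correspondence theorem these subgroups match the subgroups of order [p] in an elementary
    abelian group of rank 2. *)
Lemma card_intermediate p U V :
    prime p -> V <| U -> p.-abelem (U / V) -> #|U : V| = (p ^ 2)%N ->
  #|intermediate U V| = p.+1.
Proof.
move=> p_pr nVU abelUV iUV; have [sVU nVU'] := andP nVU.
have oUV : #|U / V| = (p ^ 2)%N by rewrite card_quotient.
have E2 : (U / V)%G \in 'E_p^2(U / V).
  by rewrite pnElemE // !inE subxx abelUV oUV eqxx.
rewrite -(card_p1Elem_p2Elem E2) p1ElemE //.
have <- : (fun H => (H / V)%G) @: intermediate U V
          = [set X in subgroups (U / V) | #|X| == p].
  apply/setP=> X; rewrite !inE; apply/imsetP/andP=> [[H]|[sXU /eqP oX]].
    rewrite inE => /andP[pVH pHU] ->; rewrite quotientS ?proper_sub //.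
    have nVH : V <| H by apply: normalS nVU; apply: proper_sub.
    split=> //; have : #|H / V| %| p ^ 2.
      by rewrite -oUV cardSg // quotientS ?proper_sub.
    (* The order is [p ^ i] with [i <= 2]; [i = 2] contradicts [H \proper U], and [i = 0]
       contradicts [V \proper H]. *)
    case/(dvdn_pfactor _ _ p_pr)=> i; rewrite leq_eqVlt => /predU1P[-> | i_lt2].
      move=> oHV; have:= proper_card (pHU).
      rewrite -(Lagrange sVU) -(Lagrange (proper_sub pVH)) iUV.
      by rewrite -card_quotient ?normal_norm // oHV ltnn.
    case: i i_lt2 => [|[|//]] _ oHV; last by rewrite oHV.
    have:= proper_card pVH; rewrite -(Lagrange (proper_sub pVH)).
    by rewrite -card_quotient ?normal_norm // oHV muln1 ltnn.
  have [H /= defX sVH sHU] := inv_quotientS nVU sXU.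
  exists H; last by apply/val_inj.
  rewrite inE !properEcard sVH sHU /=.
  have iHV : #|H : V| = p.
    by rewrite -card_quotient -?defX ?oX // (subset_trans sHU).
  rewrite -(Lagrange sVH) -(Lagrange sVU) iHV iUV -{1}[#|V|]muln1.
  rewrite !ltn_pmul2l ?cardG_gt0 // (prime_gt1 p_pr) -{1}(expn1 p).
  by rewrite ltn_exp2l ?prime_gt1.
rewrite card_in_imset // => H K; rewrite !inE => /andP[VH HU] /andP[VK KU].
have nV (L : {group gT}) : V \proper L -> L \proper U -> V <| L.
  by move=> VL LU; apply: normalS nVU; apply: proper_sub.
move/(congr1 val) => /= eqHK.
by apply: (quotient_injG _ _ eqHK); rewrite inE nV.
Qed.

(** Any [H] between [V] and [U] satisfies [[~: H, G] \subset V \subset H], hence is normal in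
    [G]. *)
Lemma central_diamond p G U V :
    prime p -> U <| G -> V <| G -> V \subset U -> [~: U, G] \subset V ->
    p.-abelem (U / V) -> #|U : V| = (p ^ 2)%N ->
  diamond_in_normal_lattice p G U V.
Proof.
move=> p_pr nUG nVG sVU cUGV abelUV iUV.
have nVU : V <| U by apply: normalS sVU _ nVG; case/andP: nUG.
split; last 1 first.
- apply/subsetP=> H; rewrite !inE => /andP[sVH sHU].
  rewrite /normal (subset_trans sHU (normal_sub nUG)) -commg_subl.
  by rewrite (subset_trans _ sVH) // (subset_trans _ cUGV) ?commSg.
- split=> //; last first.
    by rewrite /type_pp abelUV card_quotient ?normal_norm // iUV /=.
  rewrite properEneq sVU andbT; apply/eqP => eqVU; move: iUV.
  rewrite eqVU indexgg => /esym/eqP; rewrite -(expn0 p) eqn_exp2l //.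
  exact: prime_gt1.
- exact: card_intermediate.
Qed.

(** * The sequences of iterated commutators *)

Lemma s_commS x y j : 2 <= j -> s_comm x y j.+1 = [~ s_comm x y j, x].
Proof. by move=> j_ge2; rewrite /s_comm subSn. Qed.

Lemma t_commS x y l : 2 <= l -> t_comm x y l.+1 = [~ t_comm x y l, y].
Proof. by move=> l_ge2; rewrite /t_comm subSn. Qed.

Lemma s_comm_der1 G x y j : x \in G -> y \in G -> s_comm x y j \in G^`(1).
Proof.
move=> Gx Gy; rewrite /s_comm; elim: (j - 2)%N => [|i IH] /=.
  exact: mem_commg.
by rewrite mem_commg // (subsetP (der_sub 1 G)).
Qed.

Lemma t_comm_der1 G x y l : x \in G -> y \in G -> t_comm x y l \in G^`(1).
Proof.
move=> Gx Gy; rewrite /t_comm; elim: (l - 2)%N => [|i IH] /=.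
  exact: mem_commg.
by rewrite mem_commg // (subsetP (der_sub 1 G)).
Qed.

Lemma s_comm_lcn G x y j :
  x \in G -> y \in G -> 2 <= j -> s_comm x y j \in 'L_j(G).
Proof.
move=> Gx Gy; case: j => [|[|j]] // _.
elim: j => [|j IH]; first exact: mem_commg.
by rewrite s_commS // lcnSn mem_commg.
Qed.

End Diamonds.

(** * The heading diamond and the rectangle of trailing diamonds *)

Theorem theorem2p1 (gT : finGroupType) (G : {group gT}) (x y : gT)
    (p m e : nat)
    (p_prime : prime p) (p_odd : odd p)
    (pG : p.-group G)
    (genG : G :=: <<[set x; y]>>)
    (metabG : abelian G^`(1))
    (abG : type_pp p (G / G^`(1)))
    (classG : nil_class G = (m - 1)%N)
    (coclassG : coclass p G = (e - 1)%N)
    (coclass_ge2 : (2 <= e - 1)%N)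
    (* defect of commutativity k = 0 *)
    (t_last : t_comm x y e.+1 = 1)
    (independence : Sigma x y m 3 :&: Tau x y e 3 = 1)
    (* the generators x, y are adapted: neither of the two equal mixed
       commutators [s_3, y] = [t_3, x] leaves Sigma_3, respectively T_3 *)
    (mixed_s : [~ s_comm x y 3, y] \in Sigma x y m 3)
    (mixed_t : [~ t_comm x y 3, x] \in Tau x y e 3) :
  [/\ diamond_in_normal_lattice p G G G^`(1),
      (forall j l : nat, (3 <= j <= m)%N -> (3 <= l <= e.+1)%N ->
         Sigma x y m j \x Tau x y e l = Pgroup x y m e j l)
    & (forall j l : nat, (3 <= j <= m - 1)%N -> (3 <= l <= e)%N ->
         diamond_in_normal_lattice p G
           (Pgroup x y m e j l) (Pgroup x y m e j.+1 l.+1))].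
Proof.
have Gx : x \in G by rewrite genG mem_gen ?set21.
have Gy : y \in G by rewrite genG mem_gen ?set22.
have genG' : G :=: <<[set y; x]>> by rewrite setUC.
have G's j : s_comm x y j \in G^`(1) by apply: s_comm_der1.
have G't l : t_comm x y l \in G^`(1) by apply: t_comm_der1.
have [abelGG' /eqP oGG'] := andP abG.
have G'Xp z : z \in G -> z ^+ p \in G^`(1).
  move=> Gz; have nG'z := subsetP (der_norm 1 G) z Gz.
  apply: coset_idr; first exact: groupX.
  rewrite morphX //; have [_] := abelemP p_prime abelGG'; apply.
  exact: mem_quotient.
have p_gt0 := prime_gt0 p_prime.
have mixed : [~ s_comm x y 3, y] = 1.
  have eq_mixed : [~ s_comm x y 3, y] = [~ t_comm x y 3, x].
    rewrite s_commS // t_commS //.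
    exact: commgC_der1_abelian metabG (G's 2) _ _.
  apply/set1P; rewrite -[[set 1]]/(1%g : {set gT}) -independence inE mixed_s.
  by rewrite eq_mixed.
(* Exchanging [x] and [y] carries triviality from one index to the next: [[~ [~ s_i, x], y] = [~
   [~ s_i, y], x] = [~ 1, x]]. *)
have sy i : 3 <= i -> [~ s_comm x y i, y] = 1.
  case: i => [|[|[|i]]] // _; elim: i => [//|i IH].
  by rewrite s_commS // (@commgC_der1_abelian _ G) ?IH ?comm1g.
have tx i : 3 <= i -> [~ t_comm x y i, x] = 1.
  case: i => [|[|[|i]]] // _; elim: i => [|i IH].
    rewrite -mixed s_commS // t_commS //.
    exact: commgC_der1_abelian metabG (G's 2) _ _.
  by rewrite t_commS // (@commgC_der1_abelian _ G) ?IH ?comm1g.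
have sx i : 2 <= i -> [~ s_comm x y i, x] = s_comm x y i.+1.
  by move=> i_ge2; rewrite s_commS.
have ty i : 2 <= i -> [~ t_comm x y i, y] = t_comm x y i.+1.
  by move=> i_ge2; rewrite t_commS.
(* Subtraction is truncated, so [m <= 1] would give class 0, hence a trivial group, of coclass 0. *)
have m_gt1 : 1 < m.
  rewrite ltnNge; apply/negP=> m_le1; have := coclass_ge2; rewrite -coclassG.
  have: nil_class G == 0%N by rewrite classG subn_eq0.
  by rewrite /coclass nil_class0 => /eqP->; rewrite cards1 logn1.
have e_gt1 : 1 < e.+1 by case: (e) coclass_ge2.
have sm : s_comm x y m = 1.
  have /(lcn_nil_classP _ (pgroup_nil pG)) Lm : nil_class G <= m.-1.
    by rewrite classG subn1.
  apply/set1P; rewrite -[[set 1]]/(1%g : {set gT}) -Lm prednK ?(ltnW m_gt1) //.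
  exact: s_comm_lcn.
have nS := chain_normal genG m_gt1 (leqnn m) G's sm sx sy.
have nT := chain_normal genG' e_gt1 (leqnSn _) G't t_last ty tx.
have cS := chain_comm genG m_gt1 (leqnn m) G's sm sx sy.
have cT := chain_comm genG' e_gt1 (leqnSn _) G't t_last ty tx.
have dP j l : 3 <= j -> 3 <= l ->
  Sigma x y m j \x Tau x y e l = Pgroup x y m e j l.
- move=> j_ge3 l_ge3; apply: dprodEY.
    apply: sub_abelian_cent2 metabG _ _; exact: chain_sub_der1.
  apply/trivgP; rewrite -independence; apply: setISS; exact: chainS.
have nP j l : 3 <= j -> 3 <= l -> Pgroup x y m e j l <| G.
  by move=> j_ge3 l_ge3; apply: normalY; [apply: nS | apply: nT].
have cP j l : 3 <= j -> 3 <= l ->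
  [~: Pgroup x y m e j l, G] \subset Pgroup x y m e j.+1 l.+1.
- move=> j_ge3 l_ge3; have [_ nPG] := andP (nP _ _ (leqW j_ge3) (leqW l_ge3)).
  have nV (U : {group gT}) : U <| G -> U \subset 'N(Pgroup x y m e j.+1 l.+1).
    by case/andP=> sUG _; apply: subset_trans nPG.
  rewrite -quotient_cents2 ?nV ?nP //.
  rewrite quotientY; [|exact: nV (nS _ j_ge3)|exact: nV (nT _ l_ge3)].
  rewrite join_subG !quotient_cents2r //.
    exact: subset_trans (cT _ l_ge3) (joing_subr _ _).
  exact: subset_trans (cS _ j_ge3) (joing_subl _ _).
have le_der1 : #|G^`(1)| <= p * #|Pgroup x y m e 3 3|.
  (* As [[~: N, G] \subset K], the group [N] is normalised by [G]; containing the commutators of the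
     generators, it contains [G^](1)[. Also]x ^+ p[lies in]G^[(1)], hence in [N], so [[~ y, x ^+ p]]
     lies in [K], and with it [[~ y, x] ^+ p]. *)
  set K := Pgroup x y m e 3 3; set N := (<[[~ y, x]]> <*> K)%G.
  have nKG : G \subset 'N(K) by rewrite normal_norm ?nP.
  have sKG : K \subset G by rewrite normal_sub ?nP.
  have Gyx : [~ y, x] \in G by rewrite groupR.
  have yxx : [~ [~ y, x], x] \in K.
    rewrite (subsetP (joing_subl _ _)) // (sx 2) //.
    exact: chain_succ_mem m_gt1 (leqnn m) sm sx _ _ (leqnn 3).
  have yxy : [~ [~ y, x], y] \in K.
    rewrite (subsetP (joing_subr _ _)) // (ty 2) //.
    exact: chain_succ_mem e_gt1 (leqnSn e.+1) t_last ty _ _ (leqnn 3).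
  have cNG : [~: N, G] \subset K.
    have -> : N = <<[~ y, x] |: K>> :> {set gT} by apply: joing_idl.
    apply: (commg_gen_sub genG) => //.
    - by rewrite subUset sub1set (subsetP nKG) // normG.
    - move=> a /setUP[/set1P-> //|Ka].
      by rewrite (subsetP _ _ (mem_commg Ka Gx)) // commg_subl.
    - move=> a /setUP[/set1P-> //|Ka].
      by rewrite (subsetP _ _ (mem_commg Ka Gy)) // commg_subl.
  have sKN : K \subset N := joing_subr _ _.
  have nNG : G \subset 'N(N) by rewrite -commg_subl (subset_trans cNG).
  have Nyx : [~ y, x] \in N by rewrite -cycle_subG joing_subl.
  have sG'N : G^`(1) \subset N.
    rewrite derg1 {1}genG; apply: (commg_gen_sub genG) => //.
    - by rewrite -gen_subG -genG.
    - by move=> a /set2P[]->; rewrite ?commgg ?group1.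
    - by move=> a /set2P[]->; rewrite ?commgg ?group1 // -groupV invg_comm.
  apply: leq_trans (subset_leq_card sG'N) _; apply: card_cycleY_le => //.
    exact: subsetP Gyx.
  apply: commgX_mem; rewrite ?(subsetP nKG) //.
  rewrite -groupV invg_comm (subsetP cNG) // mem_commg //.
  exact: subsetP sG'N _ (G'Xp x Gx).
have oG : #|G| = (p ^ (m - 1 + (e - 1)))%N.
  rewrite (card_pgroup pG); congr (_ ^ _)%N.
  rewrite -classG -coclassG subnKC //.
  (* The positive coclass shows that the truncated difference defining it is a genuine one. *)
  rewrite ltnW // -subn_gt0 -/(coclass p G) coclassG.
  exact: leq_trans coclass_ge2.
have leS := card_chain_le p_gt0 genG metabG (G'Xp x Gx) m_gt1 (leqnn m)
  G's sm sx sy (leqnn 3).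
have leT := card_chain_le p_gt0 genG' metabG (G'Xp y Gy) e_gt1 (leqnSn e.+1)
  G't t_last ty tx (leqnn 3).
have oST : 3 <= m -> #|Sigma x y m 3| = (p ^ (m - 3))%N /\
                     #|Tau x y e 3| = (p ^ (e.+1 - 3))%N.
  move=> m_ge3.
  have le_oo : p ^ (m - 3) * p ^ (e.+1 - 3)
               <= #|Sigma x y m 3| * #|Tau x y e 3|.
    rewrite -(@leq_pmul2l (p ^ 3)) ?expn_gt0 ?p_gt0 // -!expnD.
    rewrite (_ : _ + _ = m - 1 + (e - 1))%N; last first.
      by move: m_ge3 coclass_ge2; clear; lia.
    rewrite -oG -(Lagrange (der_sub 1 G)) mulnC.
    rewrite -card_quotient ?der_norm // oGG'.
    rewrite (dprod_card (dP 3 3 _ _)) // (expnSr p 2) -mulnA.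
    by rewrite leq_mul2l le_der1 orbT.
  split; apply/eqP; rewrite eqn_leq ?leS ?leT /=.
    rewrite -(leq_pmul2r (cardG_gt0 (Tau x y e 3))) (leq_trans _ le_oo) //.
    by rewrite leq_mul2l leT orbT.
  rewrite -(leq_pmul2l (cardG_gt0 (Sigma x y m 3))) (leq_trans _ le_oo) //.
  by rewrite leq_mul2r leS orbT.
split.
- apply: central_diamond; rewrite ?der_normal ?der_sub ?normal_refl //.
  by rewrite -card_quotient ?der_norm.
- by move=> j l /andP[j_ge3 _] /andP[l_ge3 _]; apply: dP.
move=> j l /andP[j_ge3 le_jm] /andP[l_ge3 le_le].
have lt_jm : j < m by move: j_ge3 le_jm; clear; lia.
have [oS oT] := oST (leq_trans j_ge3 (ltnW lt_jm)).
have oSj := card_chain p_gt0 genG metabG (G'Xp x Gx) m_gt1 (leqnn m)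
  G's sm sx sy oS.
have oTl := card_chain p_gt0 genG' metabG (G'Xp y Gy) e_gt1 (leqnSn e.+1)
  G't t_last ty tx oT.
set U := Pgroup x y m e j l; set V := Pgroup x y m e j.+1 l.+1.
have sVU : V \subset U.
  by apply: genS; apply: setUSS; apply: chainS.
have nUG : U <| G := nP _ _ j_ge3 l_ge3.
have nVG : V <| G := nP _ _ (leqW j_ge3) (leqW l_ge3).
have sUG' : U \subset G^`(1).
  by rewrite join_subG; apply/andP; split; apply: chain_sub_der1.
apply: central_diamond => //; first exact: cP.
  (* For exponent [p], split an element of [U] along the direct product; the [p]-th power of each
     component falls one step down its own chain. *)
  rewrite abelemE // quotient_abelian ?(abelianS sUG') //=.
  apply/exponentP=> _ /morphimP[u nVu Uu ->].
  rewrite -morphX //= coset_id //.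
  move: Uu; rewrite -(dprodW (dP _ _ j_ge3 l_ge3)) => /mulsgP[a b Sa Tb ->].
  have G'a : a \in G^`(1) by apply: subsetP Sa; apply: chain_sub_der1.
  have G'b : b \in G^`(1) by apply: subsetP Tb; apply: chain_sub_der1.
  rewrite expgMn; last exact: (centsP metabG).
  apply: groupM.
    apply: subsetP (joing_subl _ _) _ _.
    exact: chain_expn genG metabG (G'Xp x Gx) m_gt1 (leqnn m) G's sm sx sy _ _
      j_ge3 Sa.
  apply: subsetP (joing_subr _ _) _ _.
  exact: chain_expn genG' metabG (G'Xp y Gy) e_gt1 (leqnSn e.+1) G't t_last
    ty tx _ _ l_ge3 Tb.
(* Each of the two direct factors contributes one factor [p] to the index. *)
apply/eqP; rewrite -(eqn_pmul2l (cardG_gt0 V)) Lagrange //.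
rewrite -(dprod_card (dP _ _ j_ge3 l_ge3)).
rewrite -(dprod_card (dP _ _ (leqW j_ge3) (leqW l_ge3))).
rewrite [#|Sigma _ _ _ j|]oSj ?j_ge3 1?ltnW // [#|Sigma _ _ _ _|]oSj ?leqW //.
rewrite [#|Tau _ _ _ l|]oTl; last by rewrite l_ge3 leqW.
rewrite [#|Tau _ _ _ _|]oTl; last by rewrite leqW.
apply/eqP; rewrite -!expnD; congr (_ ^ _)%N.
by move: lt_jm le_le; clear; lia.
Qed.
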